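(* Let $r:\mathcal{V}\to\mathbb{P}(\mathcal{L})$ be a discrete R-congruence. Then there is a unique map $$(n^{(1)},n^{(2)}):\mathcal{F}\to \big(\mathbb{P}(\mathbb{R}^{4,2})\setminus\mathbb{P}(\mathcal{L})\big)\times\big(\mathbb{P}(\mathbb{R}^{4,2})\setminus\mathbb{P}(\mathcal{L})\big)$$ such that for every face $(ijkl)$ the Lie inversions $\sigma^{(1)}:=\sigma_{\mathfrak{n}^{(1)}}$ and $\sigma^{(2)}:=\sigma_{\mathfrak{n}^{(2)}}$ with respect to the linear sphere complexes determined by $n^{(1)}$ and $n^{(2)}$ at this face satisfy $$\sigma^{(1)}(r_i)=r_j,\quad \sigma^{(1)}(r_l)=r_k,\qquad \sigma^{(2)}(r_i)=r_l,\quad \sigma^{(2)}(r_j)=r_k .$$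
   Context: $\mathbb{R}^{4,2}$ is $\mathbb{R}^6$ with the inner product $\langle x,y\rangle=-x_1y_1+x_2y_2+x_3y_3+x_4y_4+x_5y_5-x_6y_6$; $\mathcal{L}$ is its light cone and $\mathbb{P}(\mathcal{L})\subset\mathbb{P}(\mathbb{R}^{4,2})$ its projectivization. Elements of $\mathbb{P}(\mathcal{L})$ are called (oriented) spheres; a Fraktur letter $\mathfrak{r}$ denotes arbitrary homogeneous coordinates of $r\in\mathbb{P}(\mathbb{R}^{4,2})$. Two spheres $r,s$ are in oriented contact iff $\langle\mathfrak{r},\mathfrak{s}\rangle=0$. For $a\in\mathbb{P}(\mathbb{R}^{4,2})$ the linear sphere complex determined by $a$ is $\mathbb{P}(\mathcal{L})\cap a^\perp$. If $\langle\mathfrak{a},\mathfrak{a}\rangle\neq0$, the Lie inversion with respect to $a$ is $\sigma_{\mathfrak{a}}(\mathfrak{x})=\mathfrak{x}-\frac{2\langle\mathfrak{x},\mathfrak{a}\rangle}{\langle\mathfrak{a},\mathfrak{a}\rangle}\mathfrak{a}$. Equalities between images of spheres are understood projectively. A linear system is a set $\mathbb{P}(\mathrm{span}\{\mathfrak{s}_1,\mathfrak{s}_2,\mathfrak{s}_3\})\cap\mathbb{P}(\mathcal{L})$, where $s_1,s_2,s_3$ are spheres that are pairwise not in oriented contact. $\mathcal{G}=(\mathcal{V},\mathcal{E},\mathcal{F})$ is a connected quadrilateral cell complex of degree 4 whose edges are split by coordinate direction, $\mathcal{E}=\mathcal{E}^{(1)}\sqcup\mathcal{E}^{(2)}$.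 A face is written $(ijkl)$, with vertices in cyclic order, $(ij),(kl)\in\mathcal{E}^{(1)}$ and $(jk),(il)\in\mathcal{E}^{(2)}$. A discrete R-congruence is a map $r:\mathcal{V}\to\mathbb{P}(\mathcal{L})$ such that for every face the four spheres are pairwise not in oriented contact (degenerate faces are excluded throughout) and lie in a unique linear system. *)

(* Defs.v *)
From HB Require Import structures.
From Stdlib Require Export Relations.Relation_Operators.
From mathcomp Require Export all_boot all_order all_algebra.
From mathcomp Require Export boolp classical_sets cardinality reals.

Set Implicit Arguments.
Unset Strict Implicit.
Unset Printing Implicit Defensive.

Import Order.TTheory GRing.Theory Num.Theory.

Local Open Scope classical_set_scope.
Local Open Scope card_scope.
Local Open Scope ring_scope.

Section LieGeometry.
Variable R : realType.

(* Coordinates are numbered from 0, so the timelike ones are 0 and 5. *)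
Definition lie_form (x y : 'rV[R]_6) : R :=
  - (x 0 0 * y 0 0) + x 0 1 * y 0 1 + x 0 2 * y 0 2 + x 0 3 * y 0 3
  + x 0 4 * y 0 4 - x 0 5 * y 0 5.

Definition light_cone : set 'rV[R]_6 := [set x | lie_form x x = 0].

(* Points of projective space are lines through the origin; Leibniz equality
   of [proj] is equality of lines. *)
Definition proj := {U : {vspace 'rV[R]_6} | \dim U == 1%N}.

Definition line (p : proj) : {vspace 'rV[R]_6} := val p.

(* v is a vector of homogeneous coordinates of p; this forces v != 0. *)
Definition hcoord (v : 'rV[R]_6) (p : proj) : Prop := <[v]>%VS = line p.

Definition proj_light_cone : set proj :=
  [set p | forall v, hcoord v p -> light_cone v].

Definition sphere : Type := proj_light_cone.

Definition nonsphere : Type := ~` proj_light_cone.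

Definition sphere_point (s : sphere) : proj := val s.
Definition nonsphere_point (n : nonsphere) : proj := val n.

Definition oriented_contact (r s : sphere) : Prop :=
  forall v w, hcoord v (sphere_point r) -> hcoord w (sphere_point s) ->
    lie_form v w = 0.

Definition lie_inversion (a x : 'rV[R]_6) : 'rV[R]_6 :=
  x - (2 * lie_form x a / lie_form a a) *: a.

(* The projective equality sigma_n(r) = s. *)
Definition lie_inversion_maps (n : nonsphere) (r s : sphere) : Prop :=
  forall a x, hcoord a (nonsphere_point n) -> hcoord x (sphere_point r) ->
    hcoord (lie_inversion a x) (sphere_point s).

Definition linear_system (S : set sphere) : Prop :=
  exists s1 s2 s3 : sphere,
    [/\ ~ oriented_contact s1 s2, ~ oriented_contact s2 s3,
        ~ oriented_contact s1 s3 &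
        S = [set s | (line (sphere_point s) <=
                      line (sphere_point s1) + line (sphere_point s2)
                      + line (sphere_point s3))%VS]].

End LieGeometry.

(* Incidence data of a 2-dimensional cell complex; [edge1] is the set of edges
   of the first coordinate direction, its complement that of the second. *)
Record cell_complex := CellComplex {
  vertex : Type;
  edge : Type;
  face : Type;
  ends : edge -> set vertex;
  sides : face -> set edge;
  edge1 : set edge
}.

Section CellComplex.
Variable G : cell_complex.
Implicit Types (i j k l v w : vertex G) (e : edge G) (f : face G).

Definition edge2 : set (edge G) := ~` @edge1 G.

(* "f is the face (ijkl)".  A face has several such labellings: i <-> j, k <-> l
   and i <-> l, j <-> k turn one into another.  In [quad_complex4], edges have
   two distinct ends, so that i, j, k, l are pairwise distinct. *)
Definition face_cycle f i j k l : Prop :=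
  [/\ i <> k, j <> l &
    exists ij jk kl il : edge G,
      [/\ sides f = [set ij; jk; kl; il],
          ends ij = [set i; j] /\ ends kl = [set k; l],
          ends jk = [set j; k] /\ ends il = [set i; l],
          edge1 ij /\ edge1 kl & edge2 jk /\ edge2 il]].

Definition adjacent v w : Prop := exists e, ends e = [set v; w].

Definition star v : set (edge G) := [set e | ends e v].

Definition interior_vertex v : Prop :=
  forall e, star v e -> [set f | sides f e] #= `I_2.

(* Connected quadrilateral cell complex of degree 4, with edges split by
   coordinate direction.  Boundary vertices may have any degree. *)
Record quad_complex4 : Prop := QuadComplex4 {
  edge_ends : forall e, ends e #= `I_2;
  face_quad : forall f, exists i j k l, face_cycle f i j k l;
  connected_complex : forall v w, clos_refl_trans (vertex G) adjacent v w;
  interior_degree4 : forall v, interior_vertex v -> star v #= `I_4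
}.

Definition discrete_R_congruence (R : realType)
    (r : vertex G -> sphere R) : Prop :=
  forall f i j k l, face_cycle f i j k l ->
    [/\ ~ oriented_contact (r i) (r j), ~ oriented_contact (r i) (r k),
        ~ oriented_contact (r i) (r l), ~ oriented_contact (r j) (r k) &
        ~ oriented_contact (r j) (r l)] /\
    ~ oriented_contact (r k) (r l) /\
    exists! S : set (sphere R),
      linear_system S /\ [/\ S (r i), S (r j), S (r k) & S (r l)].

End CellComplex.

(* Main.v *)
Require Import Defs.
From mathcomp Require Import ring.

(** A Lie inversion moves a point x along the direction of its centre n, so it
    can map a sphere r to a sphere s with r <> s only if n lies on the
    projective line through r and s.  Conversely, if r and s are not in oriented
    contact, that projective line meets the light cone in r and s only, and
    every other point n = alpha r + beta s on it does the job, because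
    sigma_n(r) = - (beta / alpha) s.  Hence, for spheres not in oriented contact,
    sigma_n(r) = s is the incidence condition that n lies on the line rs
    ([lie_inversion_mapsP]), which is visibly symmetric in r and s.

    Finding n^(1) at a face (ijkl) is therefore the problem of intersecting the
    projective lines r_i r_j and r_l r_k.  The linear system confines both to a
    projective plane.  They are different lines, since no line contains three
    spheres pairwise not in contact ([noncontact_notin_secant]); so they meet in
    exactly one point.  That point is not a sphere: the only spheres on the
    first line are r_i and r_j, and neither is on the second
    ([exists_unique_inversion]).  The same argument with the lines r_i r_l and
    r_j r_k gives n^(2).

    A face carries several labellings.  Since the incidence condition only
    depends on the unordered pairs of spheres at the ends of the edges of one
    direction, a solution for one labelling is a solution for all of them
    ([face_inversions_labelling]). *)

Set Implicit Arguments.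
Unset Strict Implicit.
Unset Printing Implicit Defensive.

Import Order.TTheory GRing.Theory Num.Theory.

Local Open Scope classical_set_scope.
Local Open Scope card_scope.
Local Open Scope ring_scope.

(** * Spheres, their homogeneous coordinates and Lie inversions *)

Section LieInversions.
Variable R : realType.
Implicit Types (u v w x y a : 'rV[R]_6) (p : proj R) (r s t : sphere R)
  (n : nonsphere R).

Lemma lie_formC u v : lie_form u v = lie_form v u.
Proof. by rewrite /lie_form; ring. Qed.

Lemma lie_formDl u v w : lie_form (u + v) w = lie_form u w + lie_form v w.
Proof. by rewrite /lie_form !mxE; ring. Qed.

Lemma lie_formZl c u w : lie_form (c *: u) w = c * lie_form u w.
Proof. by rewrite /lie_form !mxE; ring. Qed.

Lemma lie_formDr u v w : lie_form w (u + v) = lie_form w u + lie_form w v.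
Proof. by rewrite lie_formC lie_formDl !(lie_formC w). Qed.

Lemma lie_formZr c u w : lie_form w (c *: u) = c * lie_form w u.
Proof. by rewrite lie_formC lie_formZl (lie_formC w). Qed.

Definition lie_formE := (lie_formDl, lie_formDr, lie_formZl, lie_formZr).

Lemma hcoord_exists p : exists v, hcoord v p.
Proof.
case: p => U /= dU; exists (vpick U); apply/eqP.
rewrite eqEdim -memvE memv_pick /= dim_vline vpick0 -dimv_eq0.
by rewrite (eqP dU).
Qed.

Lemma hcoord_neq0 v p : hcoord v p -> v != 0.
Proof.
rewrite /hcoord => vp; have /eqP := valP p; rewrite -/(line p) -vp dim_vline.
by case: (v != 0).
Qed.

Lemma hcoord_line v p : hcoord v p -> <[v]>%VS = line p.
Proof. by []. Qed.

Lemma hcoordZ c v p : c != 0 -> hcoord v p -> hcoord (c *: v) p.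
Proof.
move=> c0 vp; rewrite /hcoord -vp; apply/eqP.
rewrite eqEsubv -!memvE memvZ ?memv_line //=.
by apply/vlineP; exists c^-1; rewrite scalerA mulVf ?scale1r.
Qed.

Lemma hcoord_scale v w p : hcoord v p -> hcoord w p -> exists c, w = c *: v.
Proof.
by move=> vp wp; apply/vlineP; rewrite (hcoord_line vp) -(hcoord_line wp) memv_line.
Qed.

Lemma sphere_null v s : hcoord v (sphere_point s) -> lie_form v v = 0.
Proof. by move: (valP s); rewrite inE => sL /sL. Qed.

Lemma null_sphere_point v p :
  hcoord v p -> lie_form v v = 0 -> proj_light_cone p.
Proof.
move=> vp v0 w wp; have [c ->] := hcoord_scale vp wp.
by rewrite /light_cone /= !lie_formE v0 !mulr0.
Qed.

Lemma nonsphere_nonnull v n :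
  hcoord v (nonsphere_point n) -> lie_form v v != 0.
Proof.
move=> vn; apply/eqP => v0; move: (valP n); rewrite inE; apply.
exact: null_sphere_point vn v0.
Qed.

Lemma noncontact_form v w r s : ~ oriented_contact r s ->
  hcoord v (sphere_point r) -> hcoord w (sphere_point s) -> lie_form v w != 0.
Proof.
move=> nc vr ws; apply/eqP => vw0; apply: nc => v' w' v'r w's.
have [c ->] := hcoord_scale vr v'r; have [d ->] := hcoord_scale ws w's.
by rewrite !lie_formE vw0 !mulr0.
Qed.

Lemma oriented_contact_sym r s : oriented_contact r s -> oriented_contact s r.
Proof. by move=> rs v w vs wr; rewrite lie_formC; apply: rs. Qed.

Lemma mem_addv_line a v w :
  reflect (exists al be, a = al *: v + be *: w) (a \in <[v]> + <[w]>)%VS.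
Proof.
apply: (iffP memv_addP) => [[_ /vlineP[al ->] [_ /vlineP[be ->] ->]]|].
  by exists al, be.
by move=> [al [be ->]]; exists (al *: v); rewrite ?memvZ ?memv_line //;
   exists (be *: w); rewrite ?memvZ ?memv_line.
Qed.

(** The form takes the value 2 al be <v, w> at al v + be w, so a projective line
    through two spheres not in contact meets the light cone only in them. *)
Lemma null_on_secant r s p : ~ oriented_contact r s ->
  (line p <= line (sphere_point r) + line (sphere_point s))%VS ->
  proj_light_cone p -> p = sphere_point r \/ p = sphere_point s.
Proof.
move=> nc; have [v vr] := hcoord_exists (sphere_point r).
have [w ws] := hcoord_exists (sphere_point s).
have [a ap] := hcoord_exists p.
rewrite -(hcoord_line vr) -(hcoord_line ws) -(hcoord_line ap) -memvE.
move=> /mem_addv_line[al [be aE]] /(_ _ ap); rewrite /light_cone /= aE !lie_formE.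
rewrite (sphere_null vr) (sphere_null ws) (lie_formC w v) => eq0.
have /eqP : al * be * lie_form v w *+ 2 = 0 by rewrite -[RHS]eq0; ring.
rewrite mulrn_eq0 /= mulf_eq0 (negPf (noncontact_form nc vr ws)) orbF mulf_eq0.
have a0 := hcoord_neq0 ap.
case/orP => /eqP z0; move: aE a0; rewrite z0 scale0r ?add0r ?addr0 => aE;
  rewrite aE scaler_eq0 negb_or => /andP[c0 _].
- right; apply: val_inj; rewrite /= -[val p]/(line p) -(hcoord_line ap) aE.
  exact: hcoordZ c0 ws.
- left; apply: val_inj; rewrite /= -[val p]/(line p) -(hcoord_line ap) aE.
  exact: hcoordZ c0 vr.
Qed.

(** The centre n lies in the span of x and sigma_n(x); conversely the inversion
    in al x + be y sends x to the multiple - (be / al) y of y, where al and be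
    do not vanish because n is not null. *)
Lemma lie_inversion_mapsP n r s : ~ oriented_contact r s ->
  lie_inversion_maps n r s <->
  (line (nonsphere_point n) <= line (sphere_point r) + line (sphere_point s))%VS.
Proof.
move=> nc; split.
  have [v vr] := hcoord_exists (sphere_point r).
  have [a an] := hcoord_exists (nonsphere_point n).
  move=> /(_ _ _ an vr); rewrite /lie_inversion; set c := _ / _ => us.
  rewrite -(hcoord_line vr) -(hcoord_line us) -(hcoord_line an) -memvE.
  have c0 : c != 0.
    apply/eqP => c0; move: us; rewrite c0 scale0r subr0 => vs.
    by have := noncontact_form nc vr vs; rewrite (sphere_null vr) eqxx.
  apply/mem_addv_line; exists c^-1, (- c^-1).
  rewrite scaleNr scalerBr opprB addrC subrK scalerA.
  by rewrite mulVf ?scale1r.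
move=> sub a v an vr; have [w ws] := hcoord_exists (sphere_point s).
move: sub; rewrite -(hcoord_line vr) -(hcoord_line ws) -(hcoord_line an) -memvE.
move=> /mem_addv_line[al [be aE]].
have vw0 := noncontact_form nc vr ws.
have := nonsphere_nonnull an.
have aaE : lie_form a a = 2 * al * be * lie_form v w.
  rewrite aE !lie_formE (sphere_null vr) (sphere_null ws) (lie_formC w v); ring.
rewrite aaE !mulf_eq0 !negb_or => /andP[/andP[/andP[two0 al0] be0] _].
have vaE : lie_form v a = be * lie_form v w.
  by rewrite aE !lie_formE (sphere_null vr); ring.
have -> : lie_inversion a v = - (be / al) *: w.
  rewrite /lie_inversion aaE vaE.
  have -> : 2 * (be * lie_form v w) / (2 * al * be * lie_form v w) = al^-1.
    by field; rewrite al0 be0 vw0.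
  rewrite aE scalerDr !scalerA mulVf // scale1r opprD addrA subrr add0r.
  by rewrite scaleNr mulrC.
by apply: hcoordZ ws; rewrite oppr_eq0 mulf_neq0 ?invr_eq0.
Qed.

(** * Intersecting secants of a linear system *)

Lemma line_dim p : \dim (line p) = 1%N.
Proof. exact/eqP/(valP p). Qed.

Lemma line_inj p q : line p = line q -> p = q.
Proof. exact: val_inj. Qed.

Lemma line_sub_eq p q : (line p <= line q)%VS -> p = q.
Proof. by move=> pq; apply/line_inj/eqP; rewrite eqEdim pq !line_dim. Qed.

Lemma line_capv p (U : {vspace 'rV[R]_6}) :
  ~~ (line p <= U)%VS -> (U :&: line p = 0)%VS.
Proof.
have [v vp] := hcoord_exists p; rewrite -(hcoord_line vp) -memvE => vU.
apply/eqP; rewrite -subv0; apply/subvP => x /memv_capP[xU /vlineP[c xE]].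
rewrite memv0 xE; move: xU; rewrite xE; have [->|c0] := eqVneq c 0.
  by rewrite scale0r eqxx.
by move=> /(memvZ c^-1); rewrite scalerA mulVf // scale1r (negPf vU).
Qed.

Lemma dimv_add_line p (U : {vspace 'rV[R]_6}) :
  ~~ (line p <= U)%VS -> \dim (U + line p) = (\dim U).+1.
Proof.
by move=> /line_capv cap0; rewrite dimv_disjoint_sum // line_dim addn1.
Qed.

Lemma noncontact_neq r s : ~ oriented_contact r s ->
  sphere_point r <> sphere_point s.
Proof.
move=> nc rs; have [v vr] := hcoord_exists (sphere_point r).
have vs : hcoord v (sphere_point s) by rewrite -rs.
by have := noncontact_form nc vr vs; rewrite (sphere_null vr) eqxx.
Qed.

Lemma noncontact_sum2_dim r s : ~ oriented_contact r s ->
  \dim (line (sphere_point r) + line (sphere_point s)) = 2.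
Proof.
move=> nc; rewrite dimv_add_line ?line_dim //.
by apply/negP => /line_sub_eq /esym /(noncontact_neq nc).
Qed.

Lemma noncontact_notin_secant r s t : ~ oriented_contact r s ->
  ~ oriented_contact r t -> ~ oriented_contact s t ->
  ~~ (line (sphere_point t) <= line (sphere_point r) + line (sphere_point s))%VS.
Proof.
move=> rs rt st; apply/negP => /(null_on_secant rs) /(_ (set_mem (valP t))).
by case=> /esym; apply: noncontact_neq.
Qed.

Lemma noncontact_sum3_dim r s t : ~ oriented_contact r s ->
  ~ oriented_contact r t -> ~ oriented_contact s t ->
  \dim (line (sphere_point r) + line (sphere_point s) + line (sphere_point t))
  = 3.
Proof.
move=> rs rt st; rewrite dimv_add_line ?noncontact_sum2_dim //.
exact: noncontact_notin_secant.
Qed.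

(** Four points of a conic: the secants ab and dc are distinct lines of a
    projective plane, and their intersection is off the conic. *)
Lemma exists_unique_inversion (a b c d : sphere R) (W : {vspace 'rV[R]_6}) :
    ~ oriented_contact a b -> ~ oriented_contact d c ->
    ~ oriented_contact a c -> ~ oriented_contact a d ->
    ~ oriented_contact b c -> ~ oriented_contact b d ->
    (\dim W <= 3)%N ->
    [/\ (line (sphere_point a) <= W)%VS, (line (sphere_point b) <= W)%VS,
        (line (sphere_point c) <= W)%VS & (line (sphere_point d) <= W)%VS] ->
  exists! n, lie_inversion_maps n a b /\ lie_inversion_maps n d c.
Proof.
move=> ab dc ac ad bc bd dW [aW bW cW dW'].
set A := (line (sphere_point a) + line (sphere_point b))%VS.
set D := (line (sphere_point d) + line (sphere_point c))%VS.
have dimAD : \dim (A + D) = 3.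
  apply/eqP; rewrite eqn_leq; apply/andP; split.
    by apply: leq_trans dW; apply: dimvS; rewrite !subv_add aW bW cW dW'.
  rewrite -(noncontact_sum3_dim ab ac bc); apply: dimvS.
  by rewrite addvS // addvSr.
have dimAcapD : \dim (A :&: D) == 1%N.
  (* dim (A + D) + dim (A :&: D) = dim A + dim D reads 3 + _ = 2 + 2. *)
  have := dimv_sum_cap A D.
  by rewrite dimAD !noncontact_sum2_dim // => /eqP; rewrite -(eqn_add2l 3).
pose p : proj R := exist _ (A :&: D)%VS dimAcapD.
have pA : (line p <= A)%VS by exact: capvSl.
have pD : (line p <= D)%VS by exact: capvSr.
have pN : p \in ~` @proj_light_cone R.
  rewrite inE => /(null_on_secant ab pA).
  have da : ~ oriented_contact d a by move/oriented_contact_sym.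
  have ca : ~ oriented_contact c a by move/oriented_contact_sym.
  have db : ~ oriented_contact d b by move/oriented_contact_sym.
  have cb : ~ oriented_contact c b by move/oriented_contact_sym.
  case=> pE; move: pD; rewrite pE; apply/negP; exact: noncontact_notin_secant.
exists (exist _ p pN); split; first by split; apply/lie_inversion_mapsP.
move=> n [/(lie_inversion_mapsP _ ab) nA /(lie_inversion_mapsP _ dc) nD].
by apply/val_inj/esym/line_sub_eq; rewrite subv_cap nA.
Qed.

Lemma lie_inversion_maps_sym n r s : ~ oriented_contact r s ->
  lie_inversion_maps n r s -> lie_inversion_maps n s r.
Proof.
move=> rs /(lie_inversion_mapsP _ rs) nrs.
apply/lie_inversion_mapsP; last by rewrite addvC.
by move/oriented_contact_sym.
Qed.

Lemma linear_system_span (S : set (sphere R)) : linear_system S ->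
  exists2 W : {vspace 'rV[R]_6}, (\dim W <= 3)%N &
    forall s, S s -> (line (sphere_point s) <= W)%VS.
Proof.
move=> [s1 [s2 [s3 [c12 c23 c13 ->]]]]; eexists; last by move=> s; apply.
by rewrite noncontact_sum3_dim.
Qed.

End LieInversions.

(** * Labellings of a face *)

Section Labellings.
Variable G : cell_complex.
Implicit Types (i j k l v w : vertex G) (e : edge G) (f : face G).

Lemma set2_eq (T : Type) (x y v w : T) : v <> w ->
  [set x; y] = [set v; w] -> (v = x /\ w = y) \/ (v = y /\ w = x).
Proof.
move=> vw E.
have : [set x; y] v by rewrite E; left.
have : [set x; y] w by rewrite E; right.
by move=> [] /= wE [] /= vE; subst; auto; case: vw.
Qed.

Lemma ends_neq (hG : quad_complex4 G) e v w : ends e = [set v; w] -> v <> w.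
Proof.
move=> eE vw; suff /card_eq_II : `I_1 #= `I_2 by [].
apply: card_eq_trans (edge_ends hG e).
by rewrite eE vw setUid card_eq_sym card_set1.
Qed.

Lemma face_cycle_edge1 f i j k l e : face_cycle f i j k l ->
  sides f e -> edge1 e -> ends e = [set i; j] \/ ends e = [set k; l].
Proof.
move=> [_ _ [ij [jk [kl [il [-> [ijE klE] [jkE ilE] _ [jk2 il2]]]]]]].
by move=> /= [[[->|->]|->]|->]; auto.
Qed.

Lemma face_cycle_edge2 f i j k l e : face_cycle f i j k l ->
  sides f e -> edge2 e -> ends e = [set j; k] \/ ends e = [set i; l].
Proof.
move=> [_ _ [ij [jk [kl [il [-> [ijE klE] [jkE ilE] [ij1 kl1] _]]]]]].
by move=> /= [[[->|->]|->]|->]; auto.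
Qed.

Lemma lie_inversion_maps_ends (R : realType) (r : vertex G -> sphere R) n
    i j v w :
  v <> w -> ~ oriented_contact (r i) (r j) -> lie_inversion_maps n (r i) (r j) ->
  [set v; w] = [set i; j] -> lie_inversion_maps n (r v) (r w).
Proof.
move=> vw nc nij /esym /(set2_eq vw) [] [-> ->] //.
exact: lie_inversion_maps_sym.
Qed.

(** Each side of a face in a given direction has, in every labelling, the same
    pair of ends up to order, and an inversion exchanges the spheres there. *)
Lemma face_inversions_labelling (hG : quad_complex4 G) (R : realType)
    (r : vertex G -> sphere R) (hr : discrete_R_congruence r)
    (n1 n2 : nonsphere R) f i j k l i' j' k' l' :
  face_cycle f i j k l -> face_cycle f i' j' k' l' ->
  (lie_inversion_maps n1 (r i) (r j) /\ lie_inversion_maps n1 (r l) (r k)) /\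
  (lie_inversion_maps n2 (r i) (r l) /\ lie_inversion_maps n2 (r j) (r k)) ->
  (lie_inversion_maps n1 (r i') (r j') /\ lie_inversion_maps n1 (r l') (r k')) /\
  (lie_inversion_maps n2 (r i') (r l') /\ lie_inversion_maps n2 (r j') (r k')).
Proof.
move=> F F' [[nij nlk] [nil njk]].
have [[ij _ il jk _] [kl _]] := hr _ _ _ _ _ F.
have nkl : lie_inversion_maps n1 (r k) (r l).
  by apply: lie_inversion_maps_sym nlk => /oriented_contact_sym.
have dir1 e v w : sides f e -> edge1 e -> ends e = [set v; w] ->
    lie_inversion_maps n1 (r v) (r w).
  move=> fe e1 eE; have vw := ends_neq hG eE.
  case: (face_cycle_edge1 F fe e1); rewrite eE.
    exact: lie_inversion_maps_ends.
  exact: lie_inversion_maps_ends.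
have dir2 e v w : sides f e -> edge2 e -> ends e = [set v; w] ->
    lie_inversion_maps n2 (r v) (r w).
  move=> fe e2 eE; have vw := ends_neq hG eE.
  case: (face_cycle_edge2 F fe e2); rewrite eE.
    exact: lie_inversion_maps_ends.
  exact: lie_inversion_maps_ends.
case: F' => _ _ [eij [ejk [ekl [eil [fE [ijE klE] [jkE ilE] [ij1 kl1] [jk2 il2]]]]]].
split; split.
- by apply: dir1 ijE => //; rewrite fE /=; auto.
- by apply: (dir1 ekl) => //; [rewrite fE /=; auto | rewrite setUC].
- by apply: dir2 ilE => //; rewrite fE /=; auto.
- by apply: dir2 jkE => //; rewrite fE /=; auto.
Qed.

End Labellings.

Theorem proposition3p2 (R : realType) (G : cell_complex)
    (hG : quad_complex4 G) (r : vertex G -> sphere R)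
    (hr : discrete_R_congruence r) :
  exists! n : face G -> nonsphere R * nonsphere R,
    forall (f : face G) (i j k l : vertex G), face_cycle f i j k l ->
      (lie_inversion_maps (n f).1 (r i) (r j) /\
       lie_inversion_maps (n f).1 (r l) (r k)) /\
      (lie_inversion_maps (n f).2 (r i) (r l) /\
       lie_inversion_maps (n f).2 (r j) (r k)).
Proof.
have face_solution f : exists m : nonsphere R * nonsphere R,
    (forall i j k l, face_cycle f i j k l ->
      (lie_inversion_maps m.1 (r i) (r j) /\
       lie_inversion_maps m.1 (r l) (r k)) /\
      (lie_inversion_maps m.2 (r i) (r l) /\
       lie_inversion_maps m.2 (r j) (r k))) /\
    (forall m' : nonsphere R * nonsphere R,
      (forall i j k l, face_cycle f i j k l ->
        (lie_inversion_maps m'.1 (r i) (r j) /\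
         lie_inversion_maps m'.1 (r l) (r k)) /\
        (lie_inversion_maps m'.2 (r i) (r l) /\
         lie_inversion_maps m'.2 (r j) (r k))) -> m = m').
  have [i [j [k [l F]]]] := face_quad hG f.
  have [[ij ik il jk jl] [kl [S [[/linear_system_span[W dW SW] [Si Sj Sk Sl]] _]]]]
    := hr _ _ _ _ _ F.
  have lk : ~ oriented_contact (r l) (r k) by move/oriented_contact_sym.
  have lj : ~ oriented_contact (r l) (r j) by move/oriented_contact_sym.
  have WE : [/\ (line (sphere_point (r i)) <= W)%VS,
                (line (sphere_point (r j)) <= W)%VS,
                (line (sphere_point (r k)) <= W)%VS &
                (line (sphere_point (r l)) <= W)%VS] by split; apply: SW.
  have [n1 [n1E n1U]] := exists_unique_inversion ij lk ik il jk jl dW WE.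
  have WE' : [/\ (line (sphere_point (r i)) <= W)%VS,
                 (line (sphere_point (r l)) <= W)%VS,
                 (line (sphere_point (r k)) <= W)%VS &
                 (line (sphere_point (r j)) <= W)%VS] by case: WE.
  have [n2 [n2E n2U]] := exists_unique_inversion il jk ik ij lk lj dW WE'.
  exists (n1, n2); split=> [i' j' k' l' F'|[m1 m2] /(_ _ _ _ _ F) [m1E m2E]].
    exact: (face_inversions_labelling hG hr F F').
  by rewrite (n1U _ m1E) (n2U _ m2E).
have [n nP] := choice face_solution.
exists n; split=> [f|n' n'P]; first by have [] := nP f.
by apply/funext => f; have [_] := nP f; apply; exact: n'P.
Qed.
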